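(* Let \( \kappa \) be any infinite cardinal and let \( T \) be a (not necessarily countable) complete first-order theory in a relational language \( \mathcal{L} \) of size \( \leq \kappa \). The following are equivalent: (1) \( T \) is \( \kappa \)-categorical; (2) \( \mathrm{rk}_B({\cong^\kappa_T}) = 0 \), i.e.\ \( \cong^\kappa_T \) is clopen (in \( \mathrm{Mod}^\kappa_T \times \mathrm{Mod}^\kappa_T \)); (3) the isomorphism class \( [\mathcal{M}]_{\cong} \) is (cl)open in \( \mathrm{Mod}^\kappa_T \) for every \( \mathcal{M} \in \mathrm{Mod}^\kappa_T \); (4) there is \( \mathcal{M} \in \mathrm{Mod}^\kappa_T \) such that \( [\mathcal{M}]_{\cong} \) is clopen in \( \mathrm{Mod}^\kappa_T \). In particular, there is no complete non-\( \kappa \)-categorical first-order theory \( T \) (in a language of size \( \leq \kappa \)) for which \( \cong^\kappa_T \) is a nontrivial open set.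
   Context: \( \mathrm{Mod}^\kappa_{\mathcal{L}} \) is the space of \( \mathcal{L} \)-structures with domain \( \kappa \), identified with \( \prod_{i} {}^{({}^{n_i}\kappa)}2 \) (characteristic functions of the relations \( R_i \) of arity \( n_i \)), equipped with the logic topology generated by the sets \( N_{\mathcal{Q}} = \{ \mathcal{M} \in \mathrm{Mod}^\kappa_{\mathcal{L}} \mid \mathcal{Q} \text{ is a substructure of the } \mathcal{L}'\text{-reduct of } \mathcal{M} \} \), where \( \mathcal{L}' \subseteq \mathcal{L} \) has size \( < \kappa \) and \( \mathcal{Q} \) is an \( \mathcal{L}' \)-structure with domain bounded in \( \kappa \). \( \mathrm{Mod}^\kappa_T \subseteq \mathrm{Mod}^\kappa_{\mathcal{L}} \) is the subspace of models of \( T \), \( \cong^\kappa_T \) is the isomorphism relation on \( \mathrm{Mod}^\kappa_T \), viewed as a subset of \( \mathrm{Mod}^\kappa_T \times \mathrm{Mod}^\kappa_T \), and \( [\mathcal{M}]_{\cong} \) is the isomorphism class of \( \mathcal{M} \) in \( \mathrm{Mod}^\kappa_T \). The Borel rank \( \mathrm{rk}_B(A) \) of a \( \kappa^+ \)-Borel set \( A \) is the least \( \alpha \geq 1 \) with \( A \in \boldsymbol{\Sigma}^0_\alpha \cup \boldsymbol{\Pi}^0_\alpha \), with the convention that \( \mathrm{rk}_B(A) = 0 \) when \( A \) is clopen.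
   Formalization: The equivalence of (1)–(4) is stated for complete theories T that have an infinite model; for the theory of a finite structure the space of models on κ is empty, so (2) and (3) hold vacuously while (4) fails. *)

(* Defs.v *)
From HB Require Import structures.
From mathcomp Require Import all_boot all_order.
From mathcomp Require Import boolp classical_sets functions cardinality.
From mathcomp Require Import topology.

Set Implicit Arguments.
Unset Strict Implicit.
Unset Printing Implicit Defensive.

Local Open Scope classical_set_scope.
Local Open Scope card_scope.

Record language := Language {
  relsym :> Type;
  arity : relsym -> nat }.

Definition structure (L : language) (D : Type) : Type :=
  forall R : L, (arity R).-tuple D -> bool.

Definition sublanguage (L : language) (S : set L) : language :=
  @Language S (fun R => arity (\val R)).

Definition reduct (L : language) (S : set L) (D : Type) (M : structure L D) :
    structure (sublanguage S) D :=
  fun R v => M (\val R) v.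

Definition substructure (L : language) (U : Type) (D : set U)
    (Q : structure L D) (M : structure L U) : Prop :=
  forall (R : L) (v : (arity R).-tuple D), Q R v = M R (map_tuple \val v).

Definition isomorphic (L : language) (D E : Type)
    (M : structure L D) (N : structure L E) : Prop :=
  exists f : D -> E, bijective f /\
    forall (R : L) (v : (arity R).-tuple D), M R v = N R (map_tuple f v).

(* [formula L n] consists of the formulas whose free variables are among
   v_0, ..., v_(n-1); [All] binds v_0 and shifts the other variables by one. *)
Inductive formula (L : language) : nat -> Type :=
| Bot n : formula L n
| Eq n : 'I_n -> 'I_n -> formula L n
| Rel n (R : L) : (arity R).-tuple 'I_n -> formula L n
| Imp n : formula L n -> formula L n -> formula L n
| All n : formula L n.+1 -> formula L n.

Definition sentence (L : language) : Type := formula L 0.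

Definition neg (L : language) n (phi : formula L n) : formula L n :=
  Imp phi (Bot L n).

Fixpoint sat (L : language) (D : Type) (M : structure L D) n
    (phi : formula L n) : n.-tuple D -> Prop :=
  match phi in formula _ n return n.-tuple D -> Prop with
  | Bot _ => fun _ => False
  | Eq _ i j => fun s => tnth s i = tnth s j
  | Rel _ R v => fun s => M R (map_tuple (tnth s) v)
  | Imp _ phi psi => fun s => sat M phi s -> sat M psi s
  | All _ phi => fun s => forall d : D, sat M phi [tuple of d :: s]
  end.

Definition holds (L : language) (D : Type) (M : structure L D)
    (phi : sentence L) : Prop :=
  sat M phi [tuple].

(* The domain of a first-order structure is nonempty. *)
Definition models (L : language) (T : set (sentence L)) (D : Type)
    (M : structure L D) : Prop :=
  inhabited D /\ forall phi, T phi -> holds M phi.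

Definition entails (L : language) (T : set (sentence L)) (phi : sentence L) :
    Prop :=
  forall (D : Type) (M : structure L D), models T M -> holds M phi.

Definition satisfiable (L : language) (T : set (sentence L)) : Prop :=
  exists (D : Type) (M : structure L D), models T M.

Definition complete_theory (L : language) (T : set (sentence L)) : Prop :=
  satisfiable T /\ forall phi, entails T phi \/ entails T (neg phi).

Definition has_infinite_model (L : language) (T : set (sentence L)) : Prop :=
  exists (D : Type) (M : structure L D), infinite_set [set: D] /\ models T M.

(* The cardinal kappa is given as an infinite initial ordinal: a well-ordered
   set [K] none of whose proper initial segments is equinumerous with it. *)
Definition infinite_cardinal d (K : orderType d) : Prop :=
  [/\ well_founded (fun x y : K => (x < y)%O),
      infinite_set [set: K]
    & forall a : K, ~~ ([set: K] #<= [set x : K | (x < a)%O])].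

Definition bounded_in d (K : orderType d) (A : set K) : Prop :=
  exists a : K, forall x, A x -> (x < a)%O.

Definition categorical d (K : orderType d) (L : language)
    (T : set (sentence L)) : Prop :=
  (exists (D : Type) (M : structure L D), [set: D] #= [set: K] /\ models T M) /\
  forall (D E : Type) (M : structure L D) (N : structure L E),
    [set: D] #= [set: K] -> [set: E] #= [set: K] ->
    models T M -> models T N -> isomorphic M N.

Definition Mod d (K : orderType d) (L : language) : Type := structure L K.

Definition logic_nbhs d (K : orderType d) (L : language) (S : set L)
    (D : set K) (Q : structure (sublanguage S) D) : set (Mod K L) :=
  [set M | substructure Q (reduct (S := S) M)].

Definition logic_subbase d (K : orderType d) (L : language) :
    set (set (Mod K L)) :=
  [set N | exists (S : set L) (D : set K) (Q : structure (sublanguage S) D),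
     [/\ ~~ ([set: K] #<= S), bounded_in D & N = logic_nbhs Q]].

HB.instance Definition _ d (K : orderType d) (L : language) :=
  gen_eqMixin (Mod K L).
HB.instance Definition _ d (K : orderType d) (L : language) :=
  gen_choiceMixin (Mod K L).
HB.instance Definition _ d (K : orderType d) (L : language) :=
  @isSubBaseTopological.Build (Mod K L) (set (Mod K L))
    (@logic_subbase d K L) id.

(* As a type, [ModT K T] is the subtype of [Mod K L], with its subspace
   topology. *)
Definition ModT d (K : orderType d) (L : language) (T : set (sentence L)) :
    set (Mod K L) :=
  [set M | models T M].
Arguments ModT {d} K {L} T.

Definition iso_rel d (K : orderType d) (L : language) (T : set (sentence L)) :
    set (ModT K T * ModT K T) :=
  [set MN | isomorphic (\val MN.1) (\val MN.2)].
Arguments iso_rel {d} K {L} T.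

Definition iso_class d (K : orderType d) (L : language) (T : set (sentence L))
    (M : ModT K T) : set (ModT K T) :=
  [set N | isomorphic (\val M) (\val N)].

(* Ordinals as well-founded trees: [OSup f] is the supremum of the successors
   of the [f i].  Trees are compared up to [oeq]. *)
Inductive ordinal_tree : Type := OSup (A : Type) of A -> ordinal_tree.

Fixpoint ole (a b : ordinal_tree) : Prop :=
  match a, b with
  | OSup A f, OSup B g => forall i : A, exists j : B, ole (f i) (g j)
  end.

Definition olt (a b : ordinal_tree) : Prop :=
  match b with OSup B g => exists j : B, ole a (g j) end.

Definition oeq (a b : ordinal_tree) : Prop := ole a b /\ ole b a.

Definition ozero : ordinal_tree := OSup (fun i : void => match i with end).
Definition oone : ordinal_tree := OSup (fun _ : unit => ozero).

(* [Sigma0 K a] is the class Sigma^0_a of the kappa^+-Borel hierarchy, where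
   kappa is the cardinality of [K]: open sets for a = 1 and, for a > 1, unions
   of kappa many sets of classes Pi^0_b with 1 <= b < a. *)
Inductive Sigma0 (K : Type) (X : topologicalType) :
    ordinal_tree -> set X -> Prop :=
| Sigma0_open a (A : set X) : oeq a oone -> open A -> Sigma0 K a A
| Sigma0_union a (b : K -> ordinal_tree) (B : K -> set X) :
    olt oone a ->
    (forall k, ole oone (b k)) -> (forall k, olt (b k) a) ->
    (forall k, Sigma0 K (b k) (~` B k)) ->
    Sigma0 K a (\bigcup_k B k).

Definition Pi0 (K : Type) (X : topologicalType) (a : ordinal_tree)
    (A : set X) : Prop :=
  Sigma0 K a (~` A).

(* [borel_rank K A a] means that A is kappa^+-Borel and rk_B(A) = a. *)
Definition borel_rank (K : Type) (X : topologicalType) (A : set X)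
    (a : ordinal_tree) : Prop :=
  (clopen A /\ oeq a ozero) \/
  [/\ ~ clopen A, ole oone a, Sigma0 K a A \/ Pi0 K a A
    & forall b, ole oone b -> Sigma0 K b A \/ Pi0 K b A -> ole a b].

(* Main.v *)
(* Suppose that the isomorphism class of M is clopen and N is a model of T on
   kappa that is not isomorphic to M.  Membership in an open set depends only on
   the structure below some ordinal a < kappa, so there are a and b such that
   every model agreeing with M below a is isomorphic to M, and none agreeing with
   N below b is.  As T is complete, M and N embed into a common model P of T of
   size kappa.  Since |a|, |b| < kappa, P can be copied onto kappa so as to agree
   with M below a, and also so as to agree with N below b: a contradiction.

   The model P is an elementary submodel of an ultrapower of M indexed by the
   maps g : kappa -> M; every point x of N is sent to the class of g |-> g x, for
   an ultrafilter concentrating on the maps that preserve any given atomic fact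
   of N.  The same index set makes an ultrapower of an infinite structure contain
   kappa distinct points, which gives a model of T on kappa. *)
Require Import Defs.
From Stdlib Require List.
From HB Require Import structures.
From mathcomp Require Import all_boot all_order finmap.
From mathcomp Require Import boolp classical_sets functions cardinality.
From mathcomp Require Import topology.

Set Implicit Arguments.
Unset Strict Implicit.
Unset Printing Implicit Defensive.

Local Open Scope classical_set_scope.
Local Open Scope card_scope.

(** * Cardinal arithmetic *)

Lemma set_inj_card_le T U (A : set T) (B : set U) (f : T -> U) :
  set_fun A B f -> set_inj A f -> A #<= B.
Proof.
move=> fAB fI.
have /injfunPex[g] : exists2 f : T -> U, set_fun A B f & set_inj A f by exists f.
exact: inj_card_le g.
Qed.

Lemma card_le_set_inj T U (u : U) (A : set T) (B : set U) :
  A #<= B -> exists2 f : T -> U, set_fun A B f & set_inj A f.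
Proof.
(* The point [u] provides the default value outside [A]. *)
pose pU := isPointed.Build U u.
pose U' : pointedType := HB.pack U pU (gen_eqMixin U) (gen_choiceMixin U).
by move=> /(@pcard_leP T U')/injfunPex.
Qed.

(** Zorn's lemma yields a maximal graph of a partial injection from [A] to [B]. It exhausts [A] or
    [B], since otherwise a pair of missing points could be added. *)
Lemma card_le_total T U (A : set T) (B : set U) : A #<= B \/ B #<= A.
Proof.
pose P (G : set (T * U)) := [/\ forall p, G p -> A p.1 /\ B p.2,
  forall p q, G p -> G q -> p.1 = q.1 -> p.2 = q.2 &
  forall p q, G p -> G q -> p.2 = q.2 -> p.1 = q.1].
have [F FP Ftot|G [[GAB GF GI] Gmax]] := @Zorn_bigcup _ P.
  have pair2 p q : (\bigcup_(X in F) X) p -> (\bigcup_(X in F) X) q ->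
      exists G, [/\ P G, G p & G q].
    move=> [X FX Xp] [Y FY Yq]; have [XY|YX] := Ftot _ _ FX FY.
      by exists Y; split; [exact: FP|exact: XY|].
    by exists X; split; [exact: FP| |exact: YX].
  split=> [p [X FX Xp]|p q Up Uq|p q Up Uq].
  - by have [+ _ _] := FP _ FX; apply.
  - by have [G [[_ GF _] Gp Gq]] := pair2 _ _ Up Uq; exact: GF.
  - by have [G [[_ _ GI] Gp Gq]] := pair2 _ _ Up Uq; exact: GI.
have [Adom|/existsNP[a /not_implyP[Aa aN]]] :=
    pselect (forall a, A a -> exists b, G (a, b)).
  have [->|/set0P[a Aa]] := eqVneq A set0; first by left; exact: card_ge0.
  have [b0 _] := Adom _ Aa.
  have [f fP] : {f : T -> U & forall x, A x -> G (x, f x)}.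
    apply: (@choice _ _ (fun x y => A x -> G (x, y))) => x.
    have [/Adom[y Gy]|nA] := pselect (A x); first by exists y.
    by exists b0.
  left; apply: (@set_inj_card_le _ _ _ _ f) => [x /fP/GAB[]//|x y /set_mem/fP Gx].
  by move=> /set_mem/fP Gy /(GI _ _ Gx Gy).
have [Brng|/existsNP[b /not_implyP[Bb bN]]] :=
    pselect (forall b, B b -> exists a, G (a, b)).
  have [f fP] : {f : U -> T & forall y, B y -> G (f y, y)}.
    apply: (@choice _ _ (fun y x => B y -> G (x, y))) => y.
    have [/Brng[x Gx]|nB] := pselect (B y); first by exists x.
    by exists a.
  right; apply: (@set_inj_card_le _ _ _ _ f) => [x /fP/GAB[]//|x y /set_mem/fP Gx].
  by move=> /set_mem/fP Gy /(GF _ _ Gx Gy).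
case: (Gmax (G `|` [set (a, b)])).
  split; first by move=> p Gp; left.
  by move=> /(_ (a, b)) Gab; apply: aN; exists b; apply: Gab; right.
split=> [p [/GAB//|->//]||].
- move=> [x y] [x' y'] [Gp|[-> ->]] [Gq|[-> ->]] //=; first exact: (GF _ _ Gp Gq).
    by move=> xa; case: aN; exists y; rewrite -xa.
  by move=> xa; case: aN; exists y'; rewrite xa.
- move=> [x y] [x' y'] [Gp|[-> ->]] [Gq|[-> ->]] //=; first exact: (GI _ _ Gp Gq).
    by move=> xa; case: bN; exists x; rewrite -xa.
  by move=> xa; case: bN; exists x'; rewrite xa.
Qed.

Lemma infinite_two T (A : set T) : infinite_set A ->
  exists x y, [/\ A x, A y & x <> y].
Proof.
move=> Ainf; have [x Ax] := infinite_setN0 Ainf.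
have [f fA fI] := card_le_set_inj x (iffLR (infiniteP A) Ainf).
 exists (f 0), (f 1); split; try exact: fA.
by move/fI; rewrite !inE => /(_ I I).
Qed.

(** Two distinct points of [C] serve as tags for the two sets, so the union injects into [C * C]. *)
Lemma card_leU T U (A B : set T) (C : set U) : infinite_set C ->
  C `*` C #<= C -> A #<= C -> B #<= C -> A `|` B #<= C.
Proof.
move=> /infinite_two[x [y [Cx Cy xy]]] CC /(card_le_set_inj x)[f fA fI].
move=> /(card_le_set_inj x)[g gB gI]; apply: card_le_trans CC.
apply: (@set_inj_card_le _ _ _ _ (fun z => if pselect (A z) then (x, f z) else (y, g z))).
  move=> z; case: pselect => Az /=; first by split=> //; exact: fA.
  by case=> // Bz; split=> //; exact: gB.
move=> u v /set_mem uAB /set_mem vAB.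
case: pselect => Au; case: pselect => Av /= [].
- by move=> /fI; apply; exact: mem_set.
- by move=> /xy.
- by move=> /esym/xy.
- by case: uAB vAB => // Bu [] // Bv /gI; apply; exact: mem_set.
Qed.

Lemma card_leX T U T' U' (A : set T) (B : set U) (A' : set T') (B' : set U') :
  A #<= A' -> B #<= B' -> A `*` B #<= A' `*` B'.
Proof.
have [->|/set0P[a Aa]] := eqVneq A' set0.
  by rewrite card_le0 => /eqP -> _; rewrite set0X; exact: card_ge0.
have [->|/set0P[b Bb]] := eqVneq B' set0.
  by move=> _; rewrite card_le0 => /eqP ->; rewrite setX0; exact: card_ge0.
move=> /(card_le_set_inj a)[f fA fI] /(card_le_set_inj b)[g gB gI].
apply: (@set_inj_card_le _ _ _ _ (fun p => (f p.1, g p.2))).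
  by move=> p [/fA ? /gB ?].
move=> [x y] [x' y'] /set_mem[/= /mem_set Ax /mem_set By].
move=> /set_mem[/= /mem_set Ax' /mem_set By'] [/fI -> // /gI -> //].
Qed.

(* Zorn's lemma is applied to the graphs of injections [B * B -> B] with [B] an
   infinite subset of [A] (or the empty graph). *)
Lemma card_leXX T (A : set T) : infinite_set A -> A `*` A #<= A.
Proof.
move=> Ainf; have [a0 Aa0] := infinite_setN0 Ainf.
(* The set [B] is read off the diagonal of the graph; [P] then says that [G] is empty or the graph
   of an injection of [B * B] into [B], with [B] infinite. *)
pose dom (G : set (T * T * T)) := [set x | exists z, G (x, x, z)].
pose P (G : set (T * T * T)) := [/\ dom G `<=` A /\ (forall t, G t -> infinite_set (dom G)),
  forall p z, G (p, z) -> [/\ dom G p.1, dom G p.2 & dom G z],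
  forall x y, dom G x -> dom G y -> exists z, G (x, y, z),
  forall t u, G t -> G u -> t.1 = u.1 -> t.2 = u.2 &
  forall t u, G t -> G u -> t.2 = u.2 -> t.1 = u.1].
pose graph B (f : T * T -> T) := [set t : T * T * T | (B `*` B) t.1 /\ t.2 = f t.1].
have dom_graph B f : dom (graph B f) = B.
  apply/seteqP; split=> [x [z [[]]]//|x Bx].
  by exists (f (x, x)).
have Pgraph B f : B `<=` A -> infinite_set B -> set_fun (B `*` B) B f ->
    set_inj (B `*` B) f -> P (graph B f).
  move=> BA Binf fB fI; rewrite /P dom_graph; split.
  - by split.
  - by move=> [x y] z [[/= Bx By] ->]; split=> //; exact: fB.
  - by move=> x y Bx By; exists (f (x, y)).
  - by move=> [p z] [q w] [_ /= ->] [_ /= ->] ->.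
  - move=> [p z] [q w] [/= Bp ->] [/= Bq ->] fpq.
    by apply: fI => //; exact: mem_set.
have [F FP Ftot|G [PG Gmax]] := @Zorn_bigcup _ P.
  have pair2 p q : (\bigcup_(X in F) X) p -> (\bigcup_(X in F) X) q ->
      exists G, [/\ F G, G p & G q].
    move=> [X FX Xp] [Y FY Yq]; have [XY|YX] := Ftot _ _ FX FY.
      by exists Y; split=> //; exact: XY.
    by exists X; split=> //; exact: YX.
  have domS G : F G -> dom G `<=` dom (\bigcup_(X in F) X).
    by move=> FG x [z Gxz]; exists z, G.
  split.
  - split=> [x [z [G FG Gx]]|t [G FG Gt]].
      by have [[+ _] _ _ _ _] := FP _ FG; apply; exists z.
    have [[_ +] _ _ _ _] := FP _ FG => /(_ _ Gt).
    by apply: sub_infinite_set; exact: domS.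
  - move=> p z [G FG Gp]; have [_ + _ _ _] := FP _ FG.
    by move=> /(_ _ _ Gp)[? ? ?]; split; apply: (domS G).
  - move=> x y [z Uz] [w Uw]; have [G [FG Gz Gw]] := pair2 _ _ Uz Uw.
    have [_ _ + _ _] := FP _ FG => /(_ x y)[||v Gv].
    + by exists z.
    + by exists w.
    + by exists v, G.
  - move=> t u Ut Uu; have [G [FG Gt Gu]] := pair2 _ _ Ut Uu.
    by have [_ _ _ + _] := FP _ FG; apply.
  - move=> t u Ut Uu; have [G [FG Gt Gu]] := pair2 _ _ Ut Uu.
    by have [_ _ _ _ +] := FP _ FG; apply.
have Gsub B f : G `<` graph B f -> ~ P (graph B f) by exact: Gmax.
(* The empty graph is not maximal: a countably infinite subset of [A], with the pairing of natural
   numbers, gives a larger one. *)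
have [G0|/set0P[t0 Gt0]] := eqVneq G set0.
  have [i iA iI] := card_le_set_inj a0 (iffLR (infiniteP A) Ainf).
  have iI' : injective i by move=> m n; apply: iI; exact: mem_set.
  have rinf : infinite_set (range i).
    apply/infiniteP; apply: (@set_inj_card_le _ _ _ _ i) => [n _|]; first by exists n.
    by move=> m n _ _; exact: iI'.
  have /(card_le_set_inj a0)[f fB fI] : range i `*` range i #<= range i.
    have ri : range i #<= [set: nat] by exact: card_image_le.
    apply: card_le_trans (card_leX ri ri) _.
    rewrite setXTT (card_le_eql card_nat2).
    by apply: (@set_inj_card_le _ _ _ _ i) => [n _|m n _ _ /iI'//]; exists n.
  case: (@Gsub (range i) f); last first.
    by apply: Pgraph => // _ [n _ <-]; exact: iA.
  rewrite G0; split=> // /(_ (i 0, i 0, f (i 0, i 0)))[].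
  by split=> //; split; exists 0.
have [[BA /(_ _ Gt0) Binf] GB Gtot GF GI] := PG.
set B := dom G in BA Binf GB Gtot.
have [f fP] : {f : T * T -> T & forall p, (B `*` B) p -> G (p, f p)}.
  apply: (@choice _ _ (fun p z => (B `*` B) p -> G (p, z))) => -[x y].
  have [[/= Bx By]|nB] := pselect ((B `*` B) (x, y)); last by exists a0.
  by have [z Gz] := Gtot _ _ Bx By; exists z.
have fB : set_fun (B `*` B) B f by move=> p /fP/GB[].
have fI : set_inj (B `*` B) f.
  move=> p q /set_mem Bp /set_mem Bq fpq.
  exact: (GI _ _ (fP _ Bp) (fP _ Bq) fpq).
have BB : B `*` B #<= B by exact: set_inj_card_le fI.
have AE : A = B `|` (A `\` B) by rewrite setUDr setDv setD0 setUidr.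
(* If [A \ B] is no larger than [B], then [A] injects into [B] and the claim follows. Otherwise
   [A \ B] contains a copy [C] of [B]. Sending the new pairs of [B | C] into [C], which misses [B],
   extends the injection and contradicts maximality. *)
have [/(card_leU Binf BB (card_lexx B))|] := card_le_total (A `\` B) B.
  rewrite -AE => AB; apply: card_le_trans (card_leX AB AB) _.
  by apply: card_le_trans BB _; exact: subset_card_le.
move=> /(card_le_set_inj a0)[c cC cI].
pose C := c @` B.
have CB : C #<= B by exact: card_image_le.
have BC : B #<= C by apply: set_inj_card_le cI => x Bx; exists x.
have DB : B `|` C #<= B by exact: card_leU.
have /(card_le_set_inj a0)[e eC eI] : (B `|` C) `*` (B `|` C) #<= C.
  by apply: card_le_trans (card_leX DB DB) _; exact: card_le_trans BB BC.
have CAB : C `<=` A `\` B by move=> _ [x Bx <-]; exact: cC.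
pose g p := if pselect ((B `*` B) p) then f p else e p.
have [b Bb] := infinite_setN0 Binf.
case: (@Gsub (B `|` C) g).
  split=> [[p z] Gpz|/(_ (c b, c b, g (c b, c b)))].
    have [B1 B2 _] := GB _ _ Gpz.
    split; first by split; left.
    rewrite /= /g; case: pselect => [Bp|[]//].
    exact: (GF _ _ Gpz (fP _ Bp)).
  have Ccb : C (c b) by exists b.
  move=> H; have /GB : G (c b, c b, g (c b, c b)).
    by apply: H; split=> //; split; right.
  by move=> [/= Bcb _ _]; have [] := CAB _ Ccb.
apply: Pgraph.
- by move=> x [/BA//|/CAB[]].
- by apply: sub_infinite_set Binf; exact: subsetUl.
- move=> p Dp; rewrite /g; case: pselect => [Bp|nBp]; first by left; exact: fB.
  by right; exact: eC.
- move=> p q Dp Dq; rewrite /g.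
  case: pselect => Bp; case: pselect => Bq.
  + by move=> /fI; apply; exact: mem_set.
  + by move=> /= fe; have [_ []] := CAB _ (eC _ (set_mem Dq)); rewrite -fe; exact: fB.
  + by move=> /= fe; have [_ []] := CAB _ (eC _ (set_mem Dp)); rewrite fe; exact: fB.
  + exact: eI.
Qed.

Lemma card_eq_set_bij T U (u : U) (A : set T) (B : set U) :
  A #= B -> exists f : T -> U, set_bij A B f.
Proof.
pose pU := isPointed.Build U u.
pose U' : pointedType := HB.pack U pU (gen_eqMixin U) (gen_choiceMixin U).
by move=> /(@card_set_bijP T U').
Qed.

Lemma bijective_setT T U (f : T -> U) : set_bij [set: T] [set: U] f -> bijective f.
Proof.
move=> [_ fI fS]; have [g gP] : {g : U -> T & forall y, f (g y) = y}.
  by apply: (@choice _ _ (fun y x => f x = y)) => y; have [x _ <-] := fS y I; exists x.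
by exists g => // x; apply: fI; rewrite ?mem_setT.
Qed.

(** * Downward Loewenheim-Skolem *)

Lemma infinite_nat_inj K : infinite_set [set: K] -> exists f : nat -> K, injective f.
Proof.
move=> Kinf; have [k _] := infinite_setN0 Kinf.
have [f _ fI] := card_le_set_inj k (iffLR (infiniteP _) Kinf).
by exists f => m n; apply: fI; exact: mem_set.
Qed.

(** A list is folded by a pairing function on [K]. The length is recorded as well, since the fold
    alone does not show where the list ends. *)
Lemma card_le_seq K : infinite_set [set: K] -> exists f : seq K -> K, injective f.
Proof.
move=> Kinf; have [k _] := infinite_setN0 Kinf.
have [p _ pI] := card_le_set_inj k (card_leXX Kinf).
have {}pI : injective p by move=> x y; apply: pI; exact: mem_set.
have [f fI] := infinite_nat_inj Kinf.
pose fold := foldr (fun x y => p (x, y)) k.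
exists (fun s => p (f (size s), fold s)) => s t /pI[/fI + +].
elim: s t => [|x s IHs] [|y t]//= [st] /pI[-> fst].
by rewrite (IHs t).
Qed.

Section FormulaCode.
Variables (K : Type) (L : language) (nc : nat -> K) (lc : L -> K) (sc : seq K -> K).
Hypotheses (ncI : injective nc) (lcI : injective lc) (scI : injective sc).

(** A Goedel numbering with values in [K]: the first entry marks the constructor. The number [n] of
    variables is not coded, so injectivity holds for each fixed [n]. *)
Fixpoint fcode n (phi : formula L n) : K :=
  match phi with
  | Bot _ => sc [:: nc 0]
  | Eq _ i j => sc [:: nc 1; nc i; nc j]
  | Rel _ R v => sc [:: nc 2, lc R & map (fun i : 'I__ => nc i) v]
  | Imp _ phi psi => sc [:: nc 3; fcode phi; fcode psi]
  | All _ phi => sc [:: nc 4; fcode phi]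
  end.

Lemma fcode_inj n : injective (@fcode n).
Proof.
move=> phi; elim: phi => {n}[n|n i j|n R v|n phi IH1 psi IH2|n phi IH] psi'.
- by case: psi' => //= > /scI[] /ncI.
- case: {n} psi' i j => /= [n|n i' j'|n R v|n phi psi|n phi] i j /scI[];
    try by move=> /ncI.
  by move=> /ncI/val_inj-> /ncI/val_inj->.
- case: {n} psi' v => /= [n|n i' j'|n S w|n phi psi|n phi] v /scI[];
    try by move=> /ncI.
  move=> /lcI RS; case: S / RS w => w vw; congr Rel; apply: val_inj.
  by move: vw; apply: inj_map => i j /ncI/val_inj.
- case: {n} psi' phi psi IH1 IH2 => /= [n|n i' j'|n S w|n phi' psi'|n phi']
    phi psi IH1 IH2 /scI[]; try by move=> /ncI.
  by move=> /IH1 -> /IH2 ->.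
- case: {n} psi' phi IH => /= [n|n i' j'|n S w|n phi' psi'|n phi']
    phi IH /scI[]; try by move=> /ncI.
  by move=> /IH ->.
Qed.

End FormulaCode.

Lemma card_le_inj T U (u : U) : [set: T] #<= [set: U] -> exists f : T -> U, injective f.
Proof.
by move=> /(card_le_set_inj u)[f _ fI]; exists f => x y; apply: fI; exact: mem_set.
Qed.

(** Used to number by [K] the witness requirements of the Loewenheim-Skolem construction: a formula
    whose variable v_0 awaits a witness, with parameters for the others. *)
Lemma formula_param_surj K (L : language) :
  infinite_set [set: K] -> [set: L] #<= [set: K] ->
  exists dec : K -> {n & (formula L n.+1 * n.-tuple K)%type}, forall x, range dec x.
Proof.
move=> Kinf LK; have [k _] := infinite_setN0 Kinf.
have [nc ncI] := infinite_nat_inj Kinf.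
have [sc scI] := card_le_seq Kinf.
have [lc lcI] := card_le_inj k LK.
pose x0 : {n & (formula L n.+1 * n.-tuple K)%type} :=
  existT _ 0 (Bot L 1, [tuple]).
pose enc (x : {n & (formula L n.+1 * n.-tuple K)%type}) :=
  sc [:: nc (tag x), fcode nc lc sc (tagged x).1 & (tagged x).2].
have encI : injective enc.
  move=> [n [phi s]] [m [psi t]] /scI[] /ncI /= nm.
  case: m / nm psi t => psi t /(fcode_inj ncI lcI scI) -> st.
  by have -> : s = t by exact: val_inj.
have [dec decP] : {dec : K -> _ & forall y x, enc x = y -> dec y = x}.
  apply: (@choice _ _ (fun y x' => forall x, enc x = y -> x' = x)) => y.
  have [[x <-]|nx] := pselect (exists x, enc x = y).
    by exists x => x' /encI.
  by exists x0 => x xy; case: nx; exists x.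
by exists dec => x; exists (enc x) => //; exact: decP.
Qed.

Definition pullback (L : language) (D E : Type) (f : D -> E) (M : structure L E) :
  structure L D := fun R v => M R (map_tuple f v).

Lemma map_cons_tuple n T U (f : T -> U) x (s : n.-tuple T) :
  [tuple of f x :: map_tuple f s] = map_tuple f [tuple of x :: s].
Proof. exact: val_inj. Qed.

(** The Tarski-Vaught test. In the quantifier case, a counterexample to [All phi] is a witness for
    [neg phi], so one exists in the range of [f]. *)
Lemma tarski_vaught (L : language) (D E : Type) (f : D -> E) (M : structure L E) :
  injective f ->
  (forall n (phi : formula L n.+1) (s : n.-tuple D) (e : E),
     sat M phi [tuple of e :: map_tuple f s] ->
     exists d, sat M phi [tuple of f d :: map_tuple f s]) ->
  forall n (phi : formula L n) s,
    sat (pullback f M) phi s <-> sat M phi (map_tuple f s).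
Proof.
move=> fI fTV n phi; elim: phi => {n}[n|n i j|n R v|n phi IH1 psi IH2|n phi IH] s //=.
- by rewrite !tnth_map; split=> [->//|/fI].
- rewrite /pullback; suff -> : map_tuple f (map_tuple (tnth s) v) =
    map_tuple (tnth (map_tuple f s)) v by [].
  by apply: eq_from_tnth => i; rewrite !tnth_map.
- by rewrite IH1 IH2.
- split=> H => [e|d]; last by apply/IH; rewrite -map_cons_tuple.
  apply: contrapT => ne; have [d] := fTV _ (neg phi) s e ne.
  by apply; rewrite map_cons_tuple; apply/IH.
Qed.

(** Starting from an enumeration of [X] by [K], each stage [e m.+1] enumerates the Skolem witnesses
    over stage [e m]. The union [Y] of the ranges has the size of [K] and passes the Tarski-Vaught
    test. *)
Lemma downward_LS K (L : language) (E : Type) (M : structure L E) (X : set E) :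
  infinite_set [set: K] -> [set: L] #<= [set: K] -> X #= [set: K] ->
  exists f : K -> E, [/\ injective f, X `<=` range f &
    forall n (phi : formula L n) s,
      sat (pullback f M) phi s <-> sat M phi (map_tuple f s)].
Proof.
move=> Kinf LK XK; have [k _] := infinite_setN0 Kinf.
have [dec decS] := formula_param_surj Kinf LK.
have [x0 _] : X !=set0.
  by apply: infinite_setN0 => Xfin; apply: Kinf; rewrite -(eq_finite_set XK).
have [e0 [e0X e0I e0S]] := card_eq_set_bij x0 (card_esym XK).
pose satp (x : {n & (formula L n.+1 * n.-tuple E)%type}) d :=
  let: existT n (phi, s) := x in sat M phi [tuple of d :: s].
have [sk skP] : {sk : _ -> E & forall x d, satp x d -> satp x (sk x)}.
  apply: (@choice _ _ (fun x d' => forall d, satp x d -> satp x d')) => x.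
  have [[d dP]|nd] := pselect (exists d, satp x d); first by exists d.
  by exists (e0 k) => d dP; case: nd; exists d.
pose step (g : K -> E) y := let x := dec y in
  sk (existT (fun n => (formula L n.+1 * n.-tuple E)%type) (tag x)
    ((tagged x).1, map_tuple g (tagged x).2)).
pose e m := iter m step e0.
(* The only witness of v_0 = v_1 with parameter [e m y] is [e m y] itself, so the ranges of the
   stages increase. *)
have eS m y : exists z, e m.+1 z = e m y.
  have [z _ zE] := decS (existT _ 1 (Eq L (ord0 : 'I_2) (lift ord0 ord0), [tuple y])).
  exists z; rewrite /= /step zE /=.
  by have := @skP (existT _ 1 (Eq L (ord0 : 'I_2) (lift ord0 ord0),
    map_tuple (e m) [tuple y])) (e m y) erefl.
have eD m n y : exists z, e (n + m) z = e m y.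
  by elim: n => [|n [z <-]]; [exists y|exact: eS].
pose Y := range (fun p : nat * K => e p.1 p.2).
have XY : X `<=` Y by move=> x /e0S[y _ <-]; exists (0, y).
have YK : Y #= [set: K].
  rewrite card_eq_le; apply/andP; split; last first.
    by rewrite -(card_le_eql XK); exact: subset_card_le.
  apply: card_le_trans (card_image_le _ _) _.
  apply: card_le_trans (card_leXX Kinf); rewrite -setXTT.
  by apply: card_leX => //; exact/infiniteP.
have [f [fY fI fS]] := card_eq_set_bij x0 (card_esym YK).
have {}fI : injective f by move=> x y; apply: fI; rewrite inE.
exists f; split=> //; first by move=> x /XY/fS[y _ <-]; exists y.
apply: tarski_vaught => // n phi s d sphi.
(* A finite tuple of points of [Y] already lies in the range of a single stage; witnesses over it
   appear at the next one. *)
have [m [t tE]] : exists m (t : n.-tuple K), map_tuple f s = map_tuple (e m) t.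
  elim: n s {phi sphi} => [|n IHn] s.
    by exists 0, [tuple]; apply: val_inj; rewrite (tuple0 s).
  have [m [t tE]] := IHn (behead_tuple s).
  have [[m' y] _ /= yE] : Y (f (thead s)) by exact: fY.
  have [y' y'E] := choice (eD m m').
  have [z zE] := eD m' m y.
  exists (m' + m), [tuple of z :: map_tuple y' t]; apply: val_inj.
  transitivity (f (thead s) :: map_tuple f (behead_tuple s)).
    by rewrite {1}[s]tuple_eta.
  rewrite tE -yE -zE addnC; congr cons.
  rewrite -[RHS]/(map (e (m' + m)) (map y' t)) -map_comp.
  by apply: eq_map => i; rewrite -y'E.
have [z _ zE] := decS (existT _ n (phi, t)).
have [y _ yE] : range f (e m.+1 z) by apply: fS; exists (m.+1, z).
have stepE : e m.+1 z = sk (existT _ n (phi, map_tuple (e m) t)).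
  by rewrite /= /step zE.
exists y; rewrite yE stepE tE.
apply: (skP (existT _ n (phi, map_tuple (e m) t)) d).
by rewrite /satp -tE.
Qed.

(** * Ultrapowers *)

Section Ultrafilter.
Variables (I : Type) (U : set_system I).
Hypothesis UU : UltraFilter U.

Lemma ultra_imply (A B : set I) : U [set i | A i -> B i] <-> (U A -> U B).
Proof.
split=> [UAB UA|UAB].
  by apply: filterS (filterI UAB UA) => i [AB Ai]; exact: AB.
have [/UAB UB|UnA] := in_ultra_setVsetC A UU; first by apply: filterS UB => i Bi /=.
by apply: filterS UnA => i nAi /= /nAi.
Qed.

(** It suffices to test one [w], choosing for [w i] a counterexample to [P i] whenever there is
    one. *)
Lemma ultra_all D (P : I -> D -> Prop) (d0 : D) :
  U [set i | forall d, P i d] <-> forall w : I -> D, U [set i | P i (w i)].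
Proof.
split=> [UP w|UP]; first by apply: filterS UP => i; apply.
have [w wP] : {w : I -> D & forall i, P i (w i) -> forall d, P i d}.
  apply: (@choice _ _ (fun i x => P i x -> forall d, P i d)) => i.
  have [iP|/existsNP[d nPd]] := pselect (forall d, P i d); first by exists d0.
  by exists d => /nPd.
exact: filterS (UP w).
Qed.

(** The theorem of Los, with a chosen representative [rep e] of each class modulo [U]. The relations
    of [P] are defined through these representatives, so no independence of the choice has to be
    checked. *)
Lemma ultrapower (L : language) (D : Type) (d0 : D) (M : structure L D) :
  exists (E : Type) (P : structure L E) (rep : E -> I -> D),
    (forall w, exists e, U [set i | rep e i = w i]) /\
    forall n (phi : formula L n) (s : n.-tuple E),
      sat P phi s <-> U [set i | sat M phi (map_tuple (rep^~ i) s)].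
Proof.
pose cls (w : I -> D) := [set w' : I -> D | U [set i | w i = w' i]].
pose E := {A : set (I -> D) | exists w, A = cls w}.
pose rep (e : E) := projT1 (cid (projT2 e)).
have repK (e : E) : projT1 e = cls (rep e) by exact: (projT2 (cid (projT2 e))).
have clsE w w' : U [set i | w i = w' i] -> cls w = cls w'.
  move=> ww'; apply/seteqP; split=> v /= wv.
    by apply: filterS2 ww' wv => i /= <-.
  by apply: filterS2 ww' wv => i /= ->.
have repS w : exists e, U [set i | rep e i = w i].
  exists (exist _ (cls w) (ex_intro _ w erefl)).
  set e := exist _ _ _; have /= cw := repK e.
  have : cls (rep e) w by rewrite -cw; apply: (@filterS _ _ _ setT) => //; exact: filterT.
  by [].
have repI e e' : U [set i | rep e i = rep e' i] -> e = e'.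
  move=> /clsE; rewrite -!repK; case: e e' => [A HA] [B HB] /= AB.
  exact: eq_exist.
exists E, (fun R v => `[< U [set i | M R (map_tuple (rep^~ i) v)] >]), rep.
split=> // n phi; elim: phi => {n}[n|n i j|n R v|n phi IH1 psi IH2|n phi IH] s /=.
- by split=> // /filter_ex[].
- under eq_set => k do rewrite !tnth_map.
  by split=> [->|/repI//]; apply: (@filterS _ _ _ setT) => //; exact: filterT.
- rewrite asboolE.
  suff -> : (fun i => M R (map_tuple (rep^~ i) (map_tuple (tnth s) v)) : Prop) =
    (fun i => M R (map_tuple (tnth (map_tuple (rep^~ i) s)) v)) by [].
  apply/funext => i; congr (is_true (M R _)).
  by apply: eq_from_tnth => j; rewrite !tnth_map.
- by rewrite ultra_imply IH1 IH2.
- have consE e i : [tuple of rep e i :: map_tuple (rep^~ i) s] =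
      map_tuple (rep^~ i) [tuple of e :: s] by exact: val_inj.
  rewrite (ultra_all _ d0); split=> [sP w|sP e]; last first.
    by apply/IH; apply: filterS (sP (rep e)) => i; rewrite /mkset consE.
  have [e ew] := repS w; have /IH := sP e.
  by apply: filterS2 ew => i; rewrite /mkset -consE => <-.
Qed.

End Ultrafilter.

(** The finite intersections of the [F j] generate a proper filter, which extends to an
    ultrafilter. *)
Lemma fip_ultrafilter T (J : Type) (F : J -> set T) :
  (forall l : seq J, exists x, forall j, List.In j l -> F j x) ->
  exists U : set_system T, UltraFilter U /\ forall j, U (F j).
Proof.
move=> fip.
pose G := filter_from [set: seq J] (fun l => [set x | forall j, List.In j l -> F j x]).
have GF : ProperFilter G.
  apply: filter_from_proper => [|l _]; last exact: fip.
  apply: filter_from_filter; first by exists [::].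
  move=> l m _ _; exists (l ++ m) => // x /= xlm; split=> j jl; apply: xlm.
    by apply/List.in_or_app; left.
  by apply/List.in_or_app; right.
have [U [UU GU]] := ultraFilterLemma GF.
exists U; split=> // j; apply: GU; exists [:: j] => // x; apply; by left.
Qed.

(** * Finite parts of one structure realized in another *)

Fixpoint univ_closure (L : language) n : formula L n -> sentence L :=
  match n return formula L n -> sentence L with
  | 0 => id
  | n.+1 => fun phi => univ_closure (All phi)
  end.

Lemma holds_univ_closure (L : language) D (M : structure L D) n (phi : formula L n) :
  holds M (univ_closure phi) <-> forall s, sat M phi s.
Proof.
elim: n phi => [|n IHn] phi /=.
  by split=> [H s|]; [rewrite (tuple0 s)|exact].
rewrite IHn; split=> [H s|H s d]; last exact: H.
by rewrite [s]tuple_eta; exact: H.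
Qed.

Lemma sat_foldr_Imp (L : language) D (M : structure L D) n
    (fs : seq (formula L n)) (s : n.-tuple D) :
  ~ sat M (foldr (@Imp L n) (Bot L n) fs) s <->
  forall phi, List.In phi fs -> sat M phi s.
Proof.
elim: fs => [|phi fs IH] /=; first by split=> // _; exact.
split=> [/not_implyP[Mphi /IH fsP] psi [<-//|]|H]; first exact: fsP.
apply/not_implyP; split; first by apply: H; left.
by apply/IH => psi psifs; apply: H; right.
Qed.

Lemma mem_elems (X : eqType) (C : Type) (elems : C -> seq X) (l : seq C) c :
  List.In c l -> {subset elems c <= flatten (map elems l)}.
Proof.
elim: l => //= c' l IH [->|cl] a ac; first by rewrite mem_cat ac.
by rewrite mem_cat (IH cl) ?orbT.
Qed.

(* The conjunction of the conditions is written [~ (f_1 -> ... -> f_k -> Bot)];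
   the universal univ_closure of [f_1 -> ... -> f_k -> Bot] fails in [N], hence in
   [M]. *)
Lemma finitely_realized (L : language) (X : eqType) (x0 : X) D
    (N : structure L X) (M : structure L D) :
  (forall phi, holds M phi -> holds N phi) ->
  forall l : seq (X * X + {R : L & (arity R).-tuple X})%type,
  exists g : X -> D, forall c, List.In c l ->
    match c with
    | inl (a, b) => g a = g b -> a = b
    | inr (existT R v) => M R (map_tuple g v) = N R v
    end.
Proof.
move=> MN l.
pose elems (c : X * X + {R : L & (arity R).-tuple X}) : seq X :=
  match c with inl (a, b) => [:: a; b] | inr (existT R v) => v end.
pose xs := flatten (map elems l).
(* The successor keeps the index type nonempty; the extra variable receives every element outside
   [xs]. *)
pose idx a : 'I_(size xs).+1 := inord (index a xs).
pose s0 := [tuple nth x0 xs i | i < (size xs).+1].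
have s0K a : a \in xs -> tnth s0 (idx a) = a.
  move=> axs; rewrite tnth_mktuple inordK ?nth_index//.
  by rewrite ltnS index_size.
have elems_xs c (cl : List.In c l) := mem_elems (elems := elems) cl.
(* Each condition becomes a literal true in [N] at [s0]; for a pair of equal elements nothing is
   required, hence a tautology. *)
pose form (c : X * X + {R : L & (arity R).-tuple X}) : formula L (size xs).+1 :=
  match c with
  | inl (a, b) => if a == b then neg (Bot L _) else neg (Eq L (idx a) (idx b))
  | inr (existT R v) => let phi := Rel (map_tuple idx v) in
                        if N R v then phi else neg phi
  end.
have NF : ~ sat N (foldr (@Imp L _) (Bot L _) (map form l)) s0.
  apply/sat_foldr_Imp => _ /List.in_map_iff[c [<- cl]].
  have := elems_xs _ cl; rewrite /neg; case: c {cl} => [[a b] ab|[R v] vxs] /=.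
    case: eqP => //= anb; rewrite !s0K//; first by apply: ab; rewrite !inE eqxx orbT.
    by apply: ab; rewrite !inE eqxx.
  have vE : map_tuple (tnth s0) (map_tuple idx v) = v.
    apply: eq_from_tnth => i; rewrite tnth_map (tnth_map idx) s0K//.
    by apply: vxs; exact: mem_tnth.
  by case: ifPn => [|/negP] /=; rewrite vE.
have [t tP] : exists t, ~ sat M (foldr (@Imp L _) (Bot L _) (map form l)) t.
  by apply/existsNP => /holds_univ_closure/MN/holds_univ_closure/(_ s0)/NF.
exists (fun a => tnth t (idx a)) => c cl.
have := iffLR (sat_foldr_Imp _ _ _) tP (form c) (List.in_map _ _ _ cl).
rewrite /neg; case: c {cl} => [[a b]|[R v]] /=; first by case: eqP => //= ? ? /[swap].
have -> : map_tuple (fun a => tnth t (idx a)) v =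
    map_tuple (tnth t) (map_tuple idx v).
  by apply: eq_from_tnth => i; rewrite !tnth_map.
by case: ifPn => //= _ /negP/negbTE.
Qed.

(** * Elementary equivalence, pullbacks and isomorphism *)

Lemma complete_equiv (L : language) (T : set (sentence L)) D E
    (M : structure L D) (N : structure L E) :
  complete_theory T -> models T M -> models T N ->
  forall phi, holds M phi -> holds N phi.
Proof.
move=> [_ Tc] TM TN phi Mphi; case: (Tc phi) => [|Tn]; first exact.
by case: (Tn _ _ TM).
Qed.

Lemma equiv_models (L : language) (T : set (sentence L)) D E
    (M : structure L D) (N : structure L E) :
  inhabited E -> (forall phi, holds M phi -> holds N phi) ->
  models T M -> models T N.
Proof. by move=> iE MN [_ TM]; split=> // phi /TM/MN. Qed.

Lemma sat_pullback_bij (L : language) D E (f : D -> E) (N : structure L E) n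
    (phi : formula L n) s :
  bijective f -> sat (pullback f N) phi s <-> sat N phi (map_tuple f s).
Proof.
move=> [g fK gK]; apply: tarski_vaught; first exact: can_inj fK.
by move=> {n s} {}phi s t e; exists (g e); rewrite gK.
Qed.

Lemma holds_pullback_bij (L : language) D E (f : D -> E) (N : structure L E) phi :
  bijective f -> holds (pullback f N) phi <-> holds N phi.
Proof.
move=> fbij; rewrite /holds sat_pullback_bij//.
by have -> : map_tuple f [tuple] = [tuple] by exact: val_inj.
Qed.

(** Turns an isomorphism into an equation between structures, so that inverses and composites are
    computed by rewriting pullbacks. *)
Lemma isomorphicE (L : language) D E (M : structure L D) (N : structure L E) :
  isomorphic M N <-> exists2 f : D -> E, bijective f & M = pullback f N.
Proof.
split=> [[f [fbij fM]]|[f fbij ->]]; exists f => //.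
by apply: functional_extensionality_dep => R; apply/funext => v; exact: fM.
Qed.

Lemma map_tuple_comp n T U V (f : U -> V) (g : T -> U) (s : n.-tuple T) :
  map_tuple f (map_tuple g s) = map_tuple (f \o g) s.
Proof. by apply: val_inj; rewrite /= -map_comp. Qed.

Lemma pullback_comp (L : language) D E F (f : E -> F) (g : D -> E)
    (M : structure L F) :
  pullback g (pullback f M) = pullback (f \o g) M.
Proof.
apply: functional_extensionality_dep => R; apply/funext => v.
by rewrite /pullback map_tuple_comp.
Qed.

Lemma pullback_can (L : language) D E (f : D -> E) (g : E -> D)
    (M : structure L D) :
  cancel f g -> pullback f (pullback g M) = M.
Proof.
move=> fK; apply: functional_extensionality_dep => R; apply/funext => v.
rewrite /pullback map_tuple_comp; congr M.
by apply: val_inj => /=; rewrite (eq_map (g := id)) ?map_id.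
Qed.

Lemma isomorphic_refl (L : language) D (M : structure L D) : isomorphic M M.
Proof.
exists id; split=> [|R v]; first by exists id.
by congr M; apply: val_inj; rewrite /= map_id.
Qed.

Lemma isomorphic_sym (L : language) D E (M : structure L D) (N : structure L E) :
  isomorphic M N -> isomorphic N M.
Proof.
move=> /isomorphicE[f [g fK gK] ->]; apply/isomorphicE; exists g.
  by exists f.
by rewrite pullback_can.
Qed.

Lemma isomorphic_trans (L : language) D E F (M : structure L D)
    (N : structure L E) (P : structure L F) :
  isomorphic M N -> isomorphic N P -> isomorphic M P.
Proof.
move=> /isomorphicE[f fbij ->] /isomorphicE[g gbij ->]; apply/isomorphicE.
by exists (g \o f); [exact: bij_comp|rewrite pullback_comp].
Qed.

Lemma iso_models (L : language) (T : set (sentence L)) D E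
    (M : structure L D) (N : structure L E) :
  isomorphic M N -> models T M -> models T N.
Proof.
move=> /isomorphicE[f fbij ->] TM; have [[x] _] := TM.
apply: equiv_models TM; first by exists; exact: f x.
by move=> phi /holds_pullback_bij; apply.
Qed.

(** * Ultrapowers cut down to models on [K], and amalgamation *)

Section Ultrapower.
Variables (I : Type) (U : set_system I) (L : language) (D E : Type).
Variables (M : structure L D) (P : structure L E) (rep : E -> I -> D).
Hypothesis UU : UltraFilter U.
Hypothesis los : forall n (phi : formula L n) (s : n.-tuple E),
  sat P phi s <-> U [set i | sat M phi (map_tuple (rep^~ i) s)].

Lemma ultrapower_holds phi : holds P phi <-> holds M phi.
Proof.
rewrite /holds los; split=> [/filter_ex[i /=]|MP].
  by rewrite (tuple0 (map_tuple _ _)).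
apply: (@filterS _ _ _ setT) (filterT) => i _ /=.
by rewrite (tuple0 (map_tuple _ _)).
Qed.

(** Atomic facts can be read from any maps [t x] equal to the chosen representatives modulo [U]: a
    tuple has finitely many entries, and each is changed only off a set of [U]. *)
Lemma ultrapower_rel X (h : X -> E) (t : X -> I -> D) (R : L)
    (v : (arity R).-tuple X) b :
  (forall x, U [set i | rep (h x) i = t x i]) ->
  U [set i | M (map_tuple (t^~ i) v) = b] ->
  P (map_tuple h v) = b.
Proof.
move=> hE UM.
have Uv : U [set i | map_tuple (rep^~ i) (map_tuple h v) = map_tuple (t^~ i) v].
  have : U [set i | [seq rep (h x) i | x <- v] = [seq t x i | x <- v]].
    elim: (val v) => [|x s IH] /=.
      by apply: (@filterS _ _ _ setT) (filterT).
    by apply: filterS2 (hE x) IH => i /= -> ->.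
  by apply: filterS => i /= tv; apply: val_inj; rewrite /= -map_comp.
have {Uv}UM : U [set i | M (map_tuple (rep^~ i) (map_tuple h v)) = b].
  by apply: filterS2 Uv UM => i /= ->.
have sE (w : (arity R).-tuple E) : P w <-> U [set i | M (map_tuple (rep^~ i) w)].
  have := los (Rel (ord_tuple _)) w; rewrite /=.
  have -> : map_tuple (tnth w) (ord_tuple (arity R)) = w.
    by apply: eq_from_tnth => i; rewrite tnth_map tnth_ord_tuple.
  move=> ->; split; apply: filterS => i /=;
    have -> // : map_tuple (tnth (map_tuple (rep^~ i) w)) (ord_tuple (arity R)) =
    map_tuple (rep^~ i) w by apply: eq_from_tnth => j;
      rewrite !tnth_map tnth_ord_tuple.
case: b UM => UM; first exact/sE.
apply/negP => /sE UP; have [i /= [+ Mi]] := filter_ex (filterI UM UP).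
by rewrite Mi.
Qed.

End Ultrapower.

Lemma downward_LS_holds K (L : language) (E : Type) (P : structure L E) (X : set E) :
  infinite_set [set: K] -> [set: L] #<= [set: K] -> X #= [set: K] ->
  exists f : K -> E, [/\ injective f, X `<=` range f &
    forall phi, holds (pullback f P) phi <-> holds P phi].
Proof.
move=> Kinf LK XK; have [f [fI Xf fE]] := downward_LS P Kinf LK XK.
exists f; split=> // phi; rewrite /holds fE.
by have -> : map_tuple f [tuple] = [tuple] by exact: val_inj.
Qed.

Lemma infinite_model_card (K : eqType) (L : language) D (M : structure L D) :
  infinite_set [set: K] -> [set: L] #<= [set: K] -> infinite_set [set: D] ->
  exists N : structure L K, forall phi, holds N phi <-> holds M phi.
Proof.
move=> Kinf LK Dinf; have [d0 _] := infinite_setN0 Dinf.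
have [i iI] := infinite_nat_inj Dinf.
pose F (c : K * K) := [set g : K -> D | g c.1 = g c.2 -> c.1 = c.2].
have [l|U [UU UF]] := @fip_ultrafilter _ _ F.
  pose xs := flatten [seq [:: c.1; c.2] | c <- l].
  (* Finitely many pairs are separated by the position in the list [xs] of their entries, embedded
     into [D] by [i]. *)
  exists (fun a => i (index a xs)) => c cl.
  have cxs := @mem_elems _ _ (fun c => [:: c.1; c.2]) _ _ cl.
  move=> /iI cE; rewrite -[c.1](nth_index c.1 (s := xs)) ?cE ?nth_index//.
    by apply: cxs; rewrite !inE eqxx orbT.
  by apply: cxs; rewrite !inE eqxx.
have [E [P [rep [repS los]]]] := ultrapower UU d0 M.
have [h hE] := choice (fun a => repS (fun g : K -> D => g a)).
have hI : injective h.
  move=> a b hab; have Uab : U [set g | g a = g b].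
    by have := hE b; rewrite -hab; apply: filterS2 (hE a) => g /= <- <-.
  by have [g [/= gab]] := filter_ex (filterI Uab (UF (a, b))); apply.
have [f [_ _ fE]] := downward_LS_holds P Kinf LK (inj_card_eq (in2W hI)).
by exists (pullback f P) => phi; rewrite fE (ultrapower_holds UU los).
Qed.

(** In the ultrapower of [M] over the maps from [K] to [K], constant maps give a copy of [M] and
    evaluations a copy of [N]. Together these have the size of [K], so an elementary substructure of
    that size contains both. *)
Lemma amalgamation (K : eqType) (L : language) (M N : structure L K) :
  infinite_set [set: K] -> [set: L] #<= [set: K] ->
  (forall phi, holds M phi -> holds N phi) ->
  exists (P : structure L K) (j k : K -> K),
    [/\ forall phi, holds P phi <-> holds M phi, injective j, injective k,
        M = pullback j P & N = pullback k P].
Proof.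
move=> Kinf LK MN; have [x0 _] := infinite_setN0 Kinf.
pose F (c : K * K + {R : L & (arity R).-tuple K}) := [set g : K -> K |
  match c with
  | inl (a, b) => g a = g b -> a = b
  | inr (existT R v) => M R (map_tuple g v) = N R v
  end].
have [l|U [UU UF]] := @fip_ultrafilter _ _ F.
  exact: finitely_realized.
have [E [P [rep [repS los]]]] := ultrapower UU x0 M.
have [h hE] := choice (fun a => repS (fun _ : K -> K => a)).
have [h' h'E] := choice (fun a => repS (fun g : K -> K => g a)).
have hI : injective h.
  move=> a b hab; have Uab : U [set g | a = b].
    by have := hE b; rewrite -hab; apply: filterS2 (hE a) => g /= ha; rewrite ha.
  by have [] := filter_ex Uab.
have h'I : injective h'.
  move=> a b hab; have Uab : U [set g | g a = g b].
    by have := h'E b; rewrite -hab; apply: filterS2 (h'E a) => g /= <- <-.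
  by have [g [/= gab]] := filter_ex (filterI Uab (UF (inl (a, b)))); apply.
have XK : range h `|` range h' #= [set: K].
  rewrite card_eq_le; apply/andP; split; last first.
    by apply: (@set_inj_card_le _ _ _ _ h) => [a _|a b _ _ /hI//]; left; exists a.
  by apply: (card_leU Kinf (card_leXX Kinf)); exact: card_image_le.
have [f [fI fX fE]] := downward_LS_holds P Kinf LK XK.
have [j jE] : {j : K -> K & forall a, f (j a) = h a}.
  apply: (@choice _ _ (fun a y => f y = h a)) => a.
  by have [|y _ <-] := fX (h a); [left; exists a|exists y].
have [k kE] : {k : K -> K & forall a, f (k a) = h' a}.
  apply: (@choice _ _ (fun a y => f y = h' a)) => a.
  by have [|y _ <-] := fX (h' a); [right; exists a|exists y].
exists (pullback f P), j, k; split.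
- by move=> phi; rewrite fE (ultrapower_holds UU los).
- by move=> a b jab; apply: hI; rewrite -!jE jab.
- by move=> a b kab; apply: h'I; rewrite -!kE kab.
- rewrite pullback_comp (_ : f \o j = h); last by apply/funext => a /=.
  apply: functional_extensionality_dep => R; apply/funext => v; symmetry.
  apply: (ultrapower_rel UU los hE); apply: (@filterS _ _ _ setT) (filterT) => g _ /=.
  by congr M; apply: val_inj; rewrite /= map_id.
- rewrite pullback_comp (_ : f \o k = h'); last by apply/funext => a /=.
  apply: functional_extensionality_dep => R; apply/funext => v; symmetry.
  exact: (ultrapower_rel UU los h'E (UF (inr (existT _ R v)))).
Qed.

(** * Bijections prescribed on a small set *)

(** [K] is the union of [A] and its complement; being infinite, it injects into the larger of the
    two, which cannot be [A]. *)
Lemma card_setC_lt K (A : set K) :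
  infinite_set [set: K] -> ~~ ([set: K] #<= A) -> ~` A #= [set: K].
Proof.
move=> Kinf /negP KA; have AT : [set: K] = A `|` ~` A by rewrite setUCr.
rewrite card_eq_le; apply/andP; split; first exact: subset_card_le.
have [CA|AC] := card_le_total (~` A) A.
  have [Afin|Ainf] := pselect (finite_set A).
    case: Kinf; rewrite AT finite_setU; split=> //.
    exact: card_le_finite CA Afin.
  case: KA; rewrite AT; apply: card_leU => //; exact: card_leXX.
have [Cfin|Cinf] := pselect (finite_set (~` A)).
  case: Kinf; rewrite AT finite_setU; split=> //.
  exact: card_le_finite AC Cfin.
rewrite AT; apply: card_leU => //; exact: card_leXX.
Qed.

(** The inverse of [j] on [j @] A[is completed by a bijection between the complements of]j @[A] and
    [A], both of the size of [K]. *)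
Lemma extend_bijection K (A : set K) (j : K -> K) :
  infinite_set [set: K] -> ~~ ([set: K] #<= A) -> injective j ->
  exists2 f : K -> K, bijective f & forall x, A x -> f (j x) = x.
Proof.
move=> Kinf KA jI; have [x0 _] := infinite_setN0 Kinf.
have jAA : j @` A #= A by apply: inj_card_eq; exact: in2W.
have KjA : ~~ ([set: K] #<= j @` A) by rewrite (card_le_eqr jAA).
have /(card_eq_set_bij x0)[g [gA gI gS]] : ~` (j @` A) #= ~` A.
  apply: card_eq_trans (card_setC_lt Kinf KjA) _.
  exact: card_esym (card_setC_lt Kinf KA).
have [f fP] : {f : K -> K & forall y, (forall x, A x -> j x = y -> f y = x) /\
    (~ (j @` A) y -> f y = g y)}.
  apply: (@choice _ _ (fun y z => (forall x, A x -> j x = y -> z = x) /\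
    (~ (j @` A) y -> z = g y))) => y.
  have [[x Ax <-]|nA] := pselect ((j @` A) y).
    by exists x; split=> [x' _ /jI//|nA]; case: nA; exists x.
  by exists (g y); split=> // x Ax jx; case: nA; exists x.
have fj x : A x -> f (j x) = x by move=> Ax; have [fjx _] := fP (j x); exact: fjx.
have fg y : ~ (j @` A) y -> f y = g y by have [_] := fP y.
exists f => //; apply: bijective_setT; split=> // [y z _ _|x _].
  have [[a Aa <-]|ny] := pselect ((j @` A) y);
    have [[b Ab <-]|nz] := pselect ((j @` A) z).
  - by rewrite !fj// => ->.
  - by rewrite fj// fg// => ag; have := gA _ nz; rewrite -ag.
  - by rewrite fj// fg// => ag; have := gA _ ny; rewrite ag.
  - by rewrite !fg// => /gI; apply; exact: mem_set.
have [Ax|nAx] := pselect (A x); first by exists (j x) => //; exact: fj.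
by have [y ny yx] := gS x nAx; exists y; rewrite ?fg.
Qed.

(** * The logic topology *)

Section LogicTopology.
Variables (d : Order.disp_t) (K : orderType d) (L : language).

(** All symbols of [L] must agree, while a subbasic set looks at fewer than kappa of them; agreement
    below a suitable [a] therefore ensures membership in a given neighbourhood of [M]. *)
Definition agree_below (a : K) (M N : structure L K) : Prop :=
  forall (R : L) (v : (arity R).-tuple K),
    (forall x, x \in v -> (x < a)%O) -> M R v = N R v.

Lemma agree_belowW a b M N : (a <= b)%O -> agree_below b M N -> agree_below a M N.
Proof.
move=> ab MN R v va; apply: MN => x /va xa.
exact: Order.POrderTheory.lt_le_trans xa ab.
Qed.

(** The maximum of the finitely many domain bounds works; [x0] serves for the empty list. *)
Lemma subbase_agree (x0 : K) M (l : seq (set (Mod K L))) :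
  (forall A, A \in l -> logic_subbase A /\ A M) ->
  exists a, forall A N, A \in l -> agree_below a M N -> A N.
Proof.
elim: l => [|A l IH] AP; first by exists x0.
have [|a aP] := IH; first by move=> A' A'l; apply: AP; rewrite inE A'l orbT.
have [[S [D [Q [_ [b Db] AE]]] AM]] := AP A (mem_head _ _).
exists (Order.max a b) => A' N; rewrite inE => /orP[/eqP->|A'l] MN; last first.
  apply: aP => //; apply: agree_belowW MN.
  by rewrite Order.TotalTheory.le_max Order.POrderTheory.lexx.
have {}MN : agree_below b M N.
  by apply: agree_belowW MN; rewrite Order.TotalTheory.le_max Order.POrderTheory.lexx orbT.
rewrite AE in AM *; move=> R v; rewrite AM; apply: MN => x.
by move=> /mapP[y _ ->]; apply: Db; apply: set_valP.
Qed.

Lemma open_Mod_agree (x0 : K) (O : set (Mod K L)) M : open O -> O M ->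
  exists a, forall N, agree_below a M N -> O N.
Proof.
move=> [F Fsub <-] [B FB BM].
have [B' B'sub BE] := Fsub _ FB.
have [A AB'|a aP] := @subbase_agree x0 M (enum_fset B').
  split; first exact: set_mem (B'sub _ AB').
  by move: BM; rewrite -BE => /(_ A AB').
exists a => N MN; exists B => //; change (B N); rewrite -BE => A AB'.
exact: (aP _ _ AB' MN).
Qed.

Lemma open_ModT_agree (x0 : K) (T : set (sentence L)) (O : set (ModT K T)) M :
  open O -> O M ->
  exists a, forall N : ModT K T, agree_below a (\val M) (\val N) -> O N.
Proof.
move=> [O' O'open <-] OM; have [a aP] := open_Mod_agree x0 O'open OM.
by exists a => N; exact: aP.
Qed.

End LogicTopology.

(** * Clopen isomorphism classes and categoricity *)

Section Categoricity.
Variables (d : Order.disp_t) (K : orderType d) (L : language) (T : set (sentence L)).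
Hypotheses (hK : infinite_cardinal K) (hL : [set: L] #<= [set: K]).
Hypothesis hT : complete_theory T.

Let Kinf : infinite_set [set: K]. Proof. by case: hK. Qed.

Lemma ModT_inhabited : has_infinite_model T -> inhabited (ModT K T).
Proof.
move=> [D [M [Dinf TM]]]; have [N NE] := infinite_model_card M Kinf hL Dinf.
have [x _] := infinite_setN0 Kinf.
have TN : models T N by apply: equiv_models TM => // phi; rewrite NE.
by exists; exact: exist _ N (mem_set TN).
Qed.

(** The segment below [a] is smaller than [K], so some permutation of [K] sends [j x] back to [x]
    for all [x < a]; it carries [P] to [N]. *)
Lemma relocate (P : structure L K) (j : K -> K) (a : K) : injective j ->
  exists2 N : structure L K, isomorphic N P & agree_below a (pullback j P) N.
Proof.
move=> jI; have [_ _ /(_ a) Ka] := hK.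
have [f [g fK gK] fj] := extend_bijection Kinf Ka jI.
exists (pullback g P); first by apply/isomorphicE; exists g => //; exists f.
move=> R v va; rewrite /pullback; congr P; apply: eq_from_tnth => i.
have vi : (tnth v i < a)%O by apply: va; exact: mem_tnth.
by rewrite !tnth_map -[in RHS](fj _ vi) fK.
Qed.

Lemma iso_of_clopen (M N : ModT K T) : clopen (iso_class M) ->
  isomorphic (\val M) (\val N).
Proof.
move=> [Mo Mc]; apply: contrapT => nMN; have [x _] := infinite_setN0 Kinf.
have TM : models T (\val M) by exact: set_valP.
have TN : models T (\val N) by exact: set_valP.
have [P [j [k [PM jI kI MP NP]]]] :=
  amalgamation Kinf hL (complete_equiv hT TM TN).
have isoM : iso_class M M by exact: isomorphic_refl.
(* Openness of the class gives the bound [a] around [M], closedness the bound [b] around [N]. *)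
have [a aP] := open_ModT_agree x Mo isoM.
have [b bP] := open_ModT_agree x (closed_openC Mc) (nMN : (~` iso_class M) N).
have TP : models T P by apply: equiv_models TM => // phi; rewrite PM.
have [P1 P1P P1a] := relocate P a jI.
have [P2 P2P P2b] := relocate P b kI.
have TP1 := iso_models (isomorphic_sym P1P) TP.
have TP2 := iso_models (isomorphic_sym P2P) TP.
have MP1 : isomorphic (\val M) P1.
  by apply: (aP (exist _ P1 (mem_set TP1))); rewrite MP.
apply: (bP (exist _ P2 (mem_set TP2))); first by rewrite NP.
apply: isomorphic_trans MP1 _; apply: isomorphic_trans P1P _.
exact: isomorphic_sym.
Qed.

(** Models on any domain equinumerous with [K] are copied onto [K]; [M] supplies the existence half
    of categoricity. *)
Lemma categorical_of_iso (M : ModT K T) :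
  (forall N N' : ModT K T, isomorphic (\val N) (\val N')) -> categorical K T.
Proof.
move=> iso; split.
  by exists K, (\val M); split; [exact: card_eqxx|exact: set_valP].
have copy D (P : structure L D) : [set: D] #= [set: K] -> models T P ->
    exists N : ModT K T, isomorphic P (\val N).
  have [x _] := infinite_setN0 Kinf.
  move=> DK TP; have [f fbij] := card_eq_set_bij x DK.
  have [g fK gK] := bijective_setT fbij.
  have PN : isomorphic P (pullback g P).
    apply: isomorphic_sym; apply/isomorphicE; exists g => //.
    by exists f.
  by exists (exist _ (pullback g P) (mem_set (iso_models PN TP))).
move=> D E P Q DK EK TP TQ.
have [P' PP'] := copy _ _ DK TP; have [Q' QQ'] := copy _ _ EK TQ.
apply: isomorphic_trans PP' _; apply: isomorphic_trans (iso P' Q') _.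
exact: isomorphic_sym.
Qed.

(** The class of [M] is the section of the relation at [M], a preimage under the continuous map
    sending [N] to [(M, N)]. *)
Lemma open_iso_class : open (iso_rel K T) -> forall M : ModT K T, open (iso_class M).
Proof.
move=> isoo M.
have cont : continuous (fun N : ModT K T => (M, N)).
  by move=> N; apply: (@cvg_pair _ _ _ (nbhs N) (nbhs M) (nbhs N) _ _ _ (fun=> M) id);
    [exact: cvg_cst|exact: cvg_id].
by have := iffLR (@continuousP _ _ _) cont _ isoo.
Qed.

(** The complement of a class is a union of classes, hence open. *)
Lemma clopen_iso_class : (forall M : ModT K T, open (iso_class M)) ->
  forall M : ModT K T, clopen (iso_class M).
Proof.
move=> isoo M; split=> //; rewrite -[iso_class M]setCK; apply: open_closedC.
have -> : ~` iso_class M = \bigcup_(N in ~` iso_class M) iso_class N.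
  apply/seteqP; split=> [N nMN|P [N nMN NP] MP].
    by exists N => //; exact: isomorphic_refl.
  by apply: nMN; apply: isomorphic_trans MP _; exact: isomorphic_sym.
by apply: bigcup_open => N _.
Qed.

End Categoricity.

Theorem theorem3p3 (d : Order.disp_t) (K : orderType d)
    (hK : infinite_cardinal K)
    (L : language) (hL : [set: L] #<= [set: K])
    (T : set (sentence L)) (hT : complete_theory T) :
  (has_infinite_model T ->
    [<-> categorical K T;
         borel_rank K (iso_rel K T) ozero;
         clopen (iso_rel K T);
         forall M : ModT K T, open (iso_class M);
         forall M : ModT K T, clopen (iso_class M);
         exists M : ModT K T, clopen (iso_class M)]) /\
  ~ [/\ ~ categorical K T, open (iso_rel K T),
        iso_rel K T <> set0 & iso_rel K T <> [set: ModT K T * ModT K T]].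
Proof.
have cat (M : ModT K T) : clopen (iso_class M) -> categorical K T.
  move=> Mclopen; apply: categorical_of_iso => // N N'.
  apply: isomorphic_trans (iso_of_clopen hK hL hT N' Mclopen).
  by apply: isomorphic_sym; exact: (iso_of_clopen hK hL hT N Mclopen).
split=> [Tinf|[ncat isoo /eqP/set0P[[M N] _] _]].
  tfae.
  - move=> [_ iso]; left; split; last by split=> -[].
    have -> : iso_rel K T = setT.
      apply/seteqP; split=> // -[M N] _.
      by apply: iso; try exact: card_eqxx; exact: set_valP.
    exact: clopenT.
  (* A set that is not clopen has rank at least [oone], and [ole oone ozero] would produce an
     element of [void]. *)
  - by case=> [[]//|[_ /(_ tt)[[]]]].
  - by move=> [isoo _]; exact: open_iso_class.
  - exact: clopen_iso_class.
  (* An infinite model of [T] is what provides a model on [K] here. *)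
  - move=> isoc; have [M] := ModT_inhabited hK hL Tinf.
    by exists M; exact: isoc.
  - by move=> [M]; exact: cat.
(* Here the model [M] comes from a point of the nonempty relation. *)
apply: ncat; apply: (cat M).
by apply: clopen_iso_class; exact: open_iso_class.
Qed.
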